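(* Let $a$, $b$ and $k$ be integers with $b\geq a\geq 1$ and $k\geq 0$, and let $G$ be a finite simple graph. If $$ \kappa(G)\geq\max\Big\{\frac{2b(a+1)(b+1)+4bk+5}{4b},\ \frac{(a+1)^{2}\alpha(G)+4bk+5}{4b}\Big\}, $$ then $G$ is a fractional $(a,b,k)$-critical covered graph.
   Context: All graphs are finite, without loops or multiple edges. $\kappa(G)$ denotes the (vertex) connectivity of $G$ and $\alpha(G)$ its independence number. For positive integers $a\leq b$, given a function $h:E(G)\to[0,1]$ with $a\leq\sum_{e\ni x}h(e)\leq b$ for every vertex $x\in V(G)$, the spanning subgraph $F$ of $G$ with vertex set $V(G)$ and edge set $E_h=\{e\in E(G): h(e)>0\}$ is called a fractional $[a,b]$-factor of $G$ with indicator function $h$. A graph $G$ is a fractional $[a,b]$-covered graph if for every edge $e$ of $G$, $G$ has a fractional $[a,b]$-factor containing $e$. A graph $G$ is a fractional $(a,b,k)$-critical covered graph if $G-U$ is a fractional $[a,b]$-covered graph for every $U\subseteq V(G)$ with $|U|=k$. *)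

(* Defs.v *)
From HB Require Import structures.
From mathcomp Require Import all_boot all_order all_algebra.
From mathcomp Require Import reals.

Set Implicit Arguments.
Unset Strict Implicit.
Unset Printing Implicit Defensive.

Import Order.TTheory GRing.Theory Num.Theory.

Record sgraph := SGraph {
  vertex :> finType;
  adj : rel vertex;
  adj_sym : symmetric adj;
  adj_irrefl : irreflexive adj }.

Definition edges (G : sgraph) : {set {set G}} :=
  [set [set p.1; p.2] | p in [pred p : G * G | adj p.1 p.2]].

Section VertexDeletion.
Variables (G : sgraph) (U : {set G}).

Definition del_adj : rel {x : G | x \notin U} :=
  fun x y => adj (val x) (val y).

Lemma del_adj_sym : symmetric del_adj.
Proof. by move=> x y; apply: adj_sym. Qed.

Lemma del_adj_irrefl : irreflexive del_adj.
Proof. by move=> x; apply: adj_irrefl. Qed.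

(* G - U *)
Definition del_vertices : sgraph := SGraph del_adj_sym del_adj_irrefl.

End VertexDeletion.

Definition connected (G : sgraph) : bool :=
  [forall x : G, forall y : G, connect (@adj G) x y].

(* Convention: kappa(G) is the least size of a vertex set whose removal leaves
   a disconnected graph or at most one vertex; so kappa(K_n) = n - 1 for n >= 1.
   The full vertex set always qualifies. *)
Definition disconnecting (G : sgraph) (U : {set G}) : bool :=
  ~~ connected (del_vertices U) || (#|del_vertices U| <= 1).

Definition connectivity (G : sgraph) : nat :=
  #|[arg min_(U < [set: G] | disconnecting U) #|U|]|.

Definition independent (G : sgraph) (I : {set G}) : bool :=
  [forall x in I, forall y in I, ~~ adj x y].

Definition independence_number (G : sgraph) : nat :=
  \max_(I : {set G} | independent I) #|I|.

Section FractionalFactors.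
Variables (R : realType) (a b : nat).
Local Open Scope ring_scope.

(* The values of h outside [edges G] are irrelevant. *)
Definition frac_indicator (G : sgraph) (h : {set G} -> R) : Prop :=
  (forall e, e \in edges G -> 0 <= h e <= 1) /\
  (forall x : G, a%:R <= \sum_(e in edges G | x \in e) h e <= b%:R).

(* A spanning subgraph of G is given by its edge set F. *)
Definition frac_factor_with (G : sgraph) (F : {set {set G}})
    (h : {set G} -> R) : Prop :=
  frac_indicator h /\ F = [set e in edges G | 0 < h e].

Definition frac_factor (G : sgraph) (F : {set {set G}}) : Prop :=
  exists h : {set G} -> R, frac_factor_with F h.

Definition frac_covered (G : sgraph) : Prop :=
  forall e, e \in edges G -> exists2 F : {set {set G}}, frac_factor F & e \in F.

Definition frac_critical_covered (k : nat) (G : sgraph) : Prop :=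
  forall U : {set G}, #|U| = k -> frac_covered (del_vertices U).

End FractionalFactors.

(* Main.v *)
Require Import Defs.
From HB Require Import structures.
From mathcomp Require Import all_boot all_order all_algebra.
From mathcomp Require Import reals.
From mathcomp Require Import zify.

(* Write V for the vertex set of H := G - U and e(A, B) for the number of
   ordered adjacent pairs in A x B. Choose a set M of ordered adjacent pairs
   containing (u, v) whose row and column degrees all lie in [a, b]; half the
   number of pairs of M carried by an edge is then a fractional [a, b]-factor
   positive on uv. An alternating-path argument produces M unless
   a|T| + [T <> V] > b|S| + e(T, V \ S) for some S and some nonempty T, and S,
   T may be taken disjoint. Let W = V \ S, s = |S| and K = kappa(G) - k.
   Splitting T greedily into closed neighbourhoods N_1, ..., N_t of independent
   vertices of minimum degree, and using that K - s edges leave each N_i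
   inside W (edge cuts are at least as large as the vertex connectivity), gives
   4 (b s + e(T, W) - a|T|) >= 4 b s + 2 t (K - s) - t (a + 1)^2. The right-hand
   side is affine in s on [0, K]; it is positive at s = 0 by the first bound on
   kappa and at s = K by the second one, as t <= alpha(G). If W is a clique, the
   edge cut may be empty and the inequality is checked directly. *)

Set Implicit Arguments.
Unset Strict Implicit.
Unset Printing Implicit Defensive.

Import Order.TTheory GRing.Theory Num.Theory.

Lemma sum_nat_eq (I : finType) (j : I) : \sum_i ((i == j) : nat) = 1.
Proof.
rewrite (bigD1 j) //= eqxx big1 // => i /negbTE -> //.
Qed.

(** * Sets of ordered pairs, their degrees and alternating paths *)

Section ArcSets.
Variable V : finType.
Implicit Types (M : {set V * V}) (p : V * V).

Definition rdeg M x := \sum_y (((x, y) \in M) : nat).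
Definition cdeg M y := \sum_x (((x, y) \in M) : nat).
Definition converse M := [set p | (p.2, p.1) \in M].

Lemma rdeg_converse M x : rdeg (converse M) x = cdeg M x.
Proof. by apply: eq_bigr => y _; rewrite inE. Qed.

Lemma cdeg_converse M x : cdeg (converse M) x = rdeg M x.
Proof. by apply: eq_bigr => y _; rewrite inE. Qed.

Lemma cdegU1 M p y : p \notin M -> cdeg (p |: M) y = cdeg M y + (y == p.2).
Proof.
case: p => u v pM; rewrite addnC /cdeg.
have -> : ((y == (u, v).2) : nat) = \sum_x (((x, y) == (u, v)) : nat).
  have [->|ne] := eqVneq y v.
    rewrite -[LHS](sum_nat_eq u) /=.
    by apply: eq_bigr => x _; rewrite xpair_eqE eqxx andbT.
  by rewrite big1 //= => x _; rewrite xpair_eqE (negbTE ne) andbF.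
rewrite -big_split; apply: eq_bigr => x _; rewrite !inE.
by case: eqP => [->|] //=; rewrite (negbTE pM).
Qed.

Lemma cdegD1 M p y : p \in M -> cdeg (M :\ p) y + (y == p.2) = cdeg M y.
Proof. by move=> pM; rewrite -cdegU1 ?setD1K // !inE eqxx. Qed.

Lemma converseU1 M p : converse (p |: M) = (p.2, p.1) |: converse M.
Proof. by apply/setP=> -[x y]; case: p => u v; rewrite !inE !xpair_eqE andbC. Qed.

Lemma rdegU1 M p x : p \notin M -> rdeg (p |: M) x = rdeg M x + (x == p.1).
Proof.
by move=> pM; rewrite -!cdeg_converse converseU1 cdegU1 // inE; case: p pM.
Qed.

Lemma rdegD1 M p x : p \in M -> rdeg (M :\ p) x + (x == p.1) = rdeg M x.
Proof. by move=> pM; rewrite -rdegU1 ?setD1K // !inE eqxx. Qed.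

Variables a b : nat.
Hypothesis leab : a <= b.

(** Subtraction is truncated, so a degree above [a] never compensates for one below; the value 0
    means that all degrees are at least [a]. *)
Definition deficit M := \sum_x (a - rdeg M x) + \sum_y (a - cdeg M y).

Lemma deficit_converse M : deficit (converse M) = deficit M.
Proof.
rewrite /deficit addnC; congr (_ + _); apply: eq_bigr => x _.
  by rewrite cdeg_converse.
by rewrite rdeg_converse.
Qed.

(** The lower bound [a] is left out: it is reached by minimising [deficit]. *)
Definition admissible (E : rel V) p M :=
  [&& p \in M, [forall q in M, E q.1 q.2],
      [forall x, rdeg M x <= b] & [forall y, cdeg M y <= b]].

Lemma admissibleP (E : rel V) p M :
  reflect [/\ p \in M, forall x y, (x, y) \in M -> E x y,
              forall x, rdeg M x <= b & forall y, cdeg M y <= b]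
          (admissible E p M).
Proof.
apply: (iffP and4P) => -[pM HE /= Hr Hc]; split=> //.
- by move=> x y; move/forall_inP: HE => /(_ (x, y)).
- exact/forallP.
- exact/forallP.
- by apply/forall_inP=> -[x y]; apply: HE.
- exact/forallP.
- exact/forallP.
Qed.

Lemma admissible_converse (E : rel V) p M :
  admissible E p M ->
  admissible (fun x y => E y x) (p.2, p.1) (converse M).
Proof.
move=> /admissibleP[pM HE Hr Hc]; apply/admissibleP; split=> [|x y|x|y].
- by rewrite inE; case: p pM.
- by rewrite inE => /HE.
- by rewrite rdeg_converse.
- by rewrite cdeg_converse.
Qed.

(** Replacing [(x, y')] by [(x, y)] moves one unit from column [y'] to column [y] and keeps all row
    degrees; the prescribed pair [p] is never removed. *)
Definition alt_step (E : rel V) p M : rel V := fun y y' =>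
  [exists x, [&& E x y, (x, y) \notin M, (x, y') \in M & (x, y') != p]].

(** An alternating path may end at a column that can spare a unit, or at one that can receive a new
    pair from a row with room left. *)
Definition augmentable (E : rel V) M y :=
  (a < cdeg M y) || [exists x, [&& E x y, (x, y) \notin M & rdeg M x < b]].

(** The unit gained at [y] lowers the sum since [c y < a]; the unit lost at [y'] raises it only if
    [c y' <= a]. *)
Lemma shift_deficit (c c' : V -> nat) y y' :
  (forall z, c' z + (z == y') = c z + (z == y)) -> c y < a -> y != y' ->
  (\sum_z (a - c' z)).+1 <= \sum_z (a - c z) + (c y' <= a).
Proof.
move=> Hc ya ne; rewrite -addn1 -(sum_nat_eq y).
have -> : ((c y' <= a) : nat) = \sum_z (z == y') * (c y' <= a).
  by rewrite -big_distrl /= sum_nat_eq mul1n.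
rewrite -!big_split; apply: leq_sum => z _ /=; move: (Hc z).
have [zy|] := eqVneq z y; have [zy'|] := eqVneq z y';
  subst; rewrite ?eqxx in ne * => //.
all: lia.
Qed.

(* Only the arcs of the columns [y] and [y'] change when one alternating step
   is flipped, so the rest of a duplicate-free alternating path survives. *)
Lemma augment_path (E : rel V) p s M y :
  admissible E p M -> cdeg M y < a ->
  path (alt_step E p M) y s -> uniq (y :: s) -> augmentable E M (last y s) ->
  exists2 M', admissible E p M' & deficit M' < deficit M.
Proof.
elim: s M y => [|y' s IH] M y Madm ya.
  move=> _ _ /orP[|/existsP[x /and3P[Exy xyM xb]]] /=; first by move=> ?; lia.
  move/admissibleP: (Madm) => [pM HE Hr Hc].
  exists ((x, y) |: M).
    apply/admissibleP; split=> [|u v|u|v].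
    - by rewrite inE pM orbT.
    - by rewrite !inE => /orP[/eqP[-> ->]|/HE].
    - by rewrite rdegU1 //=; case: eqP => [->|_]; rewrite ?addn1 ?addn0.
    - rewrite cdegU1 //=; case: eqP => [->|_]; rewrite ?addn0 //; lia.
  rewrite /deficit -addnS leq_add //.
    by apply: leq_sum => u _; rewrite rdegU1 //; lia.
  rewrite -addn1 -(sum_nat_eq y) -big_split; apply: leq_sum => v _ /=.
  by rewrite cdegU1 //=; have [->|] := eqVneq v y => //=; lia.
rewrite [path _ _ _]/= => /andP[/existsP[x /and4P[Exy xyM xy'M xy'p]] Hs].
rewrite cons_uniq inE negb_or -andbA => /and3P[yy' ys Hu] aug.
move/admissibleP: (Madm) => [pM HE Hr Hc].
have xyM1 : (x, y) \notin M :\ (x, y') by rewrite inE (negbTE xyM) andbF.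
pose M' := (x, y) |: (M :\ (x, y')).
have Hr' u : rdeg M' u = rdeg M u by rewrite rdegU1 // -(rdegD1 u xy'M).
have Hc' v : cdeg M' v + (v == y') = cdeg M v + (v == y).
  by rewrite cdegU1 // -(cdegD1 v xy'M) /= addnAC.
have M'adm : admissible E p M'.
  apply/admissibleP; split=> [|u v|u|v].
  - by rewrite !inE pM andbT [p == (x, y')]eq_sym xy'p orbT.
  - by rewrite !inE => /orP[/eqP[-> ->]|/andP[_ /HE]].
  - by rewrite Hr'.
  - have [->|vy] := eqVneq v y.
      move: (Hc' y) ya leab; rewrite eqxx (negbTE yy').
      by move: (cdeg M' y) (cdeg M y) => c' c; clear; lia.
    move: (Hc' v) (Hc v); rewrite (negbTE vy).
    by move: (cdeg M' v) (cdeg M v) => c' c; clear; lia.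
have Hd : (deficit M').+1 <= deficit M + (cdeg M y' <= a).
  rewrite /deficit -addnS -addnA leq_add //.
    by apply: leq_sum => u _; rewrite Hr'.
  exact: shift_deficit Hc' ya yy'.
(* If column [y'] had more than [a] pairs, the flip already lowers the deficit. Otherwise [y'] is
   now below [a] and starts the rest of the path. *)
have [y'a|y'a] := leqP (cdeg M y') a; last first.
  by exists M' => //; move: Hd; rewrite [cdeg M y' <= a]leqNgt y'a addn0.
have {}Hd : deficit M' <= deficit M by move: Hd; rewrite y'a addn1.
have colE v : v \in y' :: s -> forall u, ((u, v) \in M') =
   ((u, v) \in M) && ((u, v) != (x, y')).
  move=> vs u; have vy : v != y.
    move: vs; rewrite inE => /predU1P[->|vs]; first by rewrite eq_sym.
    by apply: contraNneq ys => <-.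
  by rewrite !inE xpair_eqE (negbTE vy) andbF andbC.
have colE' v : v \in s -> forall u, ((u, v) \in M') = ((u, v) \in M).
  move=> vs u; rewrite colE ?inE ?vs ?orbT // xpair_eqE.
  have -> : (v == y') = false.
    by apply: contraTF vs => /eqP ->; case/andP: Hu.
  by rewrite andbF andbT.
case: (IH M' y') => //.
- move: (Hc' y') y'a; rewrite eqxx [y' == y]eq_sym (negbTE yy').
  by move: (cdeg M' y') (cdeg M y') => c' c; clear; lia.
- apply/(pathP y) => i lti; move/(pathP y): Hs => /(_ i lti).
  have zs : nth y (y' :: s) i \in y' :: s by rewrite mem_nth //= ltnW.
  case/existsP=> u /and4P[Euz uzM uzM' nep]; apply/existsP; exists u.
  by rewrite Euz colE // (negbTE uzM) colE' ?mem_nth // uzM'.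
- case/orP: aug => /= [lta|/existsP[u /and3P[Eu uM ub]]]; apply/orP.
    have : last y' s \in y' :: s := mem_last _ _.
    rewrite inE => /predU1P[eql|lins]; first by rewrite eql ltnNge y'a in lta.
    left; apply: leq_trans lta _; rewrite leq_eqVlt; apply/orP; left.
    by apply/eqP; apply: eq_bigr => u _; rewrite colE'.
  right; apply/existsP; exists u; rewrite Eu Hr' ub andbT.
  by rewrite colE ?mem_last // (negbTE uM).
- move=> M2 M2adm lt; exists M2 => //; exact: leq_trans lt Hd.
Qed.

(* The columns [T] reachable from [y] by alternating steps and the rows [S]
   from which [T] can be entered form the obstruction. *)
Lemma column_obstruction (E : rel V) p M y :
  admissible E p M -> cdeg M y < a ->
  (forall M', admissible E p M' -> deficit M <= deficit M') ->
  exists S T : {set V}, T != set0 /\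
    b * #|S| + \sum_(v in T) \sum_(u in ~: S) (E u v : nat)
      < a * #|T| + (T != setT).
Proof.
move=> Madm ya minM; move/admissibleP: (Madm) => [pM HE Hr Hc].
pose T := [set v | connect (alt_step E p M) y v].
pose S := [set u | [exists v in T, E u v && ((u, v) \notin M)]].
(* Once repetitions are removed from the path, a reachable augmentable column contradicts the
   minimality of [M]. *)
have Tnaug v : v \in T -> ~~ augmentable E M v.
  rewrite inE => /connectP[s Hs ->]; apply/negP.
  case/shortenP: Hs => s' Hs' Hu _ aug.
  have [M' /minM le lt] := augment_path Madm ya Hs' Hu aug.
  by rewrite leqNgt lt in le.
have yT : y \in T by rewrite inE connect0.
exists S, T; split; first by apply/set0Pn; exists y.
have Tle v : v \in T -> cdeg M v <= a.
  by move=> /Tnaug; rewrite negb_or -leqNgt => /andP[].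
have Sdeg u : u \in S -> rdeg M u = b.
  rewrite inE => /exists_inP[v /Tnaug]; rewrite negb_or => /andP[_ /existsPn /(_ u)].
  move=> H /andP[Euv uvM]; apply/eqP; rewrite eqn_leq Hr leqNgt.
  by move: H; rewrite Euv uvM.
have STclosed u v : u \in S -> (u, v) \in M -> (u, v) != p -> v \in T.
  rewrite inE => /exists_inP[w wT /andP[Euw uwM]] uvM nep.
  rewrite inE in wT; rewrite inE; apply: connect_trans wT (connect1 _).
  by apply/existsP; exists u; rewrite Euw uwM uvM.
have sumT : \sum_(v in T) cdeg M v < a * #|T|.
  rewrite mulnC -sum_nat_const (bigD1 y) //= [X in _ < X](bigD1 y) //=.
  by rewrite -addSn leq_add // leq_sum // => v /andP[/Tle].
apply: leq_ltn_trans (_ : _ <= \sum_(v in T) cdeg M v + (T != setT)) _; last first.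
  by rewrite ltn_add2r.
have splitT : \sum_(v in T) cdeg M v =
   \sum_(v in T) \sum_(u in S) (((u, v) \in M) : nat)
   + \sum_(v in T) \sum_(u in ~: S) (((u, v) \in M) : nat).
  rewrite -big_split; apply: eq_bigr => v _ /=.
  rewrite /cdeg (bigID (mem S)) /=; congr (_ + _).
  by apply: eq_bigl => u; rewrite in_setC.
(* A row outside [S] already has in [M] all its [E]-pairs with columns of [T]. *)
rewrite splitT addnAC leq_add //; last first.
  apply: leq_sum => v vT; apply: leq_sum => u; rewrite in_setC => uS.
  have [//|uvM] := boolP ((u, v) \in M); case Euv: (E u v) => //.
  by case/negP: uS; rewrite inE; apply/exists_inP; exists v; rewrite ?Euv.
rewrite mulnC -sum_nat_const exchange_big /=.
have -> : \sum_(u in S) b =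
   \sum_(u in S) (\sum_(v in T) (((u, v) \in M) : nat)
                  + \sum_(v in ~: T) (((u, v) \in M) : nat)).
  apply: eq_bigr => u /Sdeg <-; rewrite /rdeg (bigID (mem T)) /=.
  by congr (_ + _); apply: eq_bigl => v; rewrite in_setC.
rewrite big_split leq_add2l /=.
(* Only the pair [p] can lead from a row of [S] to a column outside [T]; this is the source of the
   term [T != setT]. *)
have [TT|neT] := eqVneq T setT.
  by rewrite big1 // => u _; rewrite TT setCT big_set0.
apply: (@leq_trans (\sum_u \sum_v (((u, v) == p) : nat))).
  rewrite [X in X <= _]big_mkcond; apply: leq_sum => u _ /=.
  case: ifP => // uS; rewrite big_mkcond; apply: leq_sum => v _ /=.
  case: ifP => //; rewrite in_setC => vT; have [uvM|//] := boolP (_ \in M).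
  by rewrite lt0b; apply: contraNT vT; exact: STclosed.
rewrite pair_bigA /= (eq_bigr (fun q : V * V => (q == p) : nat)).
  by rewrite sum_nat_eq.
by case.
Qed.

End ArcSets.

(** * Edge counts, vertex connectivity and independent sets *)

Section EdgeCount.
Variable G : sgraph.
Implicit Types A B C S T : {set G}.

Definition ecount A B := \sum_(x in A) \sum_(y in B) (adj x y : nat).

Lemma ecountC A B : ecount A B = ecount B A.
Proof.
by rewrite /ecount exchange_big; do 2!apply: eq_bigr => ? _; rewrite adj_sym.
Qed.

Lemma ecountUl A B C : [disjoint A & B] ->
  ecount (A :|: B) C = ecount A C + ecount B C.
Proof.
by move=> dAB; rewrite /ecount -bigU //; apply: eq_bigl => x; rewrite !inE.
Qed.

Lemma ecountUr A B C : [disjoint A & B] ->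
  ecount C (A :|: B) = ecount C A + ecount C B.
Proof. by move=> dAB; rewrite !(ecountC C) ecountUl. Qed.

Lemma disjointDr A B : [disjoint A & B :\: A].
Proof. by rewrite -setI_eq0 setIDA setIC setDIl setDv setI0. Qed.

Lemma ecount_subl A B C : A \subset B -> ecount A C <= ecount B C.
Proof.
move=> sAB; rewrite -(setID B A) (setIidPr sAB) ecountUl ?leq_addr //.
exact: disjointDr.
Qed.

Lemma ecount_subr A B C : A \subset B -> ecount C A <= ecount C B.
Proof. by move=> sAB; rewrite !(ecountC C) ecount_subl. Qed.

Lemma connectivity_le (U : {set G}) : disconnecting U -> connectivity G <= #|U|.
Proof.
move=> dU; rewrite /connectivity; case: arg_minnP => [|D _ /(_ U dU)] //.
rewrite /disconnecting; apply/orP; right.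
by rewrite leqW // leqn0; apply/eqP/eq_card0 => -[x xU]; have := xU; rewrite in_setT.
Qed.

Lemma connectivity_lt_card (x : G) : connectivity G < #|G|.
Proof.
have -> : #|G| = #|~: [set x]|.+1 by rewrite cardsC1 prednK //; apply/card_gt0P; exists x.
rewrite ltnS; apply: connectivity_le; apply/orP; right.
have xP : x \notin ~: [set x] by rewrite !inE negbK.
rewrite -(card1 (Sub x xP : del_vertices (~: [set x]))).
apply/subset_leq_card/subsetP=> -[y yP] _; rewrite inE -val_eqE /=.
by move: yP; rewrite !inE negbK.
Qed.

(** Off [D], the set [A] is closed under adjacency, hence a union of components, and it separates
    [x] from [y]. *)
Lemma disconnecting_cut (D A : {set G}) (x y : G) :
  x \notin D -> y \notin D -> x \in A -> y \notin A ->
  (forall u v, u \notin D -> v \notin D -> u \in A -> adj u v -> v \in A) ->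
  disconnecting D.
Proof.
move=> xD yD xA yA clA; apply/orP; left.
apply/negP=> /forallP/(_ (Sub x xD))/forallP/(_ (Sub y yD)) cxy.
have cl : closed (@adj (del_vertices D)) [pred u | val u \in A].
  apply: intro_closed => [u v|u v]; first exact: (sym_connect_sym (@adj_sym _)).
  by case: u v => [u uD] [v vD] /= uv uA; apply: clA uv.
by move: (closed_connect cl cxy); rewrite !inE /= xA (negbTE yA).
Qed.

(* If [A] and [B] are completely joined there are [#|A| * #|B|] edges between
   them; otherwise fix nonadjacent [x] and [y], and delete from each edge
   between [A] and [B] an end that is neither [x] nor [y]. *)
Lemma connectivity_le_ecount A B : A != set0 -> B != set0 -> [disjoint A & B] ->
  connectivity G <= ecount A B + #|~: (A :|: B)|.
Proof.
move=> /set0Pn[x0 x0A] /set0Pn[y0 y0B] dAB.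
have cAB : #|A| + #|B| + #|~: (A :|: B)| = #|G|.
  by rewrite -(cardsC (A :|: B)) cardsU disjoint_setI0 // cards0 subn0.
have [/forall_inP cplt|/forall_inPn[x xA /forall_inPn[y yB nxy]]] :=
    boolP [forall x in A, forall y in B, adj x y].
  have -> : ecount A B = #|A| * #|B|.
    rewrite -sum_nat_const; apply: eq_bigr => u /cplt/forall_inP uB.
    by rewrite -[RHS]muln1 -sum_nat_const; apply: eq_bigr => v /uB ->.
  have cA : 0 < #|A| by apply/card_gt0P; exists x0.
  have cB : 0 < #|B| by apply/card_gt0P; exists y0.
  (* For nonempty sets, [#|A| * #|B|] is at least [#|A| + #|B| - 1]. *)
  have := connectivity_lt_card x0; rewrite -cAB; nia.
pose f (p : G * G) := if p.1 == x then p.2 else p.1.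
pose P := [set p : G * G | [&& p.1 \in A, p.2 \in B & adj p.1 p.2]].
have cP : #|P| = ecount A B.
  rewrite /ecount pair_big -sum1_card big_mkcond [RHS]big_mkcond /=.
  apply: eq_bigr => -[u v] _ /=; rewrite inE /=.
  by case: (u \in A); case: (v \in B); case: (adj u v).
pose D := f @: P :|: ~: (A :|: B).
have yA : y \notin A by apply: contraTN yB => yA; rewrite (disjointFr dAB yA).
have xD : x \notin D.
  rewrite !inE xA /= orbF; apply/imsetP => -[[u v]]; rewrite inE /f /=.
  case/and3P=> uA vB _; case: eqVneq => [_ xv|ux xu].
    by move: vB; rewrite -xv (disjointFr dAB xA).
  by rewrite xu eqxx in ux.
have yD : y \notin D.
  rewrite !inE yB orbT /= orbF; apply/imsetP => -[[u v]]; rewrite inE /f /=.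
  case/and3P=> uA vB uv; case: eqVneq => [ux yv|_ yu].
    by move: nxy; rewrite yv -ux uv.
  by rewrite yu uA in yA.
have /connectivity_le : disconnecting D.
  apply: (disconnecting_cut xD yD xA yA) => u v uD vD uA uv.
  have : v \in A :|: B by apply: contraNT vD => vN; rewrite !inE -in_setU vN orbT.
  rewrite inE => /orP[//|vB].
  have /(imset_f f) : (u, v) \in P by rewrite inE uA vB.
  rewrite /f /=; case: ifP => _ H.
    by case/negP: vD; rewrite inE H.
  by case/negP: uD; rewrite inE H.
move/leq_trans; apply; rewrite -cP; apply: leq_trans (leq_card_setU _ _) _.
by rewrite leq_add2r leq_imset_card.
Qed.

Lemma independent_le (I : {set G}) :
  independent I -> #|I| <= independence_number G.
Proof. by move=> indI; rewrite /independence_number (bigD1 I) //= leq_maxl. Qed.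

(* Greedy choice: repeatedly pick a vertex [x] of minimum degree in [T], and
   remove its closed neighbourhood [N] from [T]. If [#|N| = n], this costs
   [2 * ecount N T + ecount N (W :\: N) >= 2 * n * (n - 1) + q], and
   [4 * n * (n - 1) - 4 * a * n >= - (a + 1) ^ 2]. *)
Lemma greedy_independent (W : {set G}) (a q : nat) :
  (forall N : {set G}, N \subset W -> N != set0 -> N != W ->
     q <= ecount N (W :\: N)) ->
  (exists x y, [/\ x \in W, y \in W, x != y & ~~ adj x y]) ->
  forall T, T \subset W -> exists I : {set G},
    [/\ I \subset T, independent I, T != set0 -> I != set0 &
     4 * a * #|T| + 2 * #|I| * q
       <= 2 * (ecount T T + ecount T W) + #|I| * a.+1 ^ 2].
Proof.
move=> cutW nclW T; have [m] := ubnP #|T|; elim: m T => // m IH T ltTm sTW.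
have [->|/set0Pn[x0 x0T]] := eqVneq T set0.
  exists set0; rewrite !cards0 !muln0 !mul0n eqxx; split=> //.
  by apply/forall_inP=> x; rewrite inE.
case: (@arg_minnP _ x0 (mem T) (fun x => \sum_(y in T) (adj x y : nat)) x0T).
move=> x /= xT minx.
pose N := [set y in T | (y == x) || adj x y].
have sNT : N \subset T by apply/subsetP=> y; rewrite inE => /andP[].
have xN : x \in N by rewrite inE xT eqxx.
have cN : #|N| = (\sum_(y in T) (adj x y : nat)).+1.
  rewrite (cardsD1 x) xN add1n; congr _.+1.
  rewrite -sum1_card big_mkcond [RHS]big_mkcond.
  apply: eq_bigr => y _; rewrite !inE.
  have [->|_] := eqVneq y x; first by rewrite adj_irrefl if_same.
  by case: (y \in T); case: (adj x y).
have eNT : #|N| * #|N|.-1 <= ecount N T.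
  rewrite -sum_nat_const; apply: leq_sum => y /(subsetP sNT) yT.
  by rewrite cN minx.
have sNW := subset_trans sNT sTW.
(* If [N = W], then [T = W] and [x] is adjacent to all other vertices of [W]. As [x] has minimum
   degree, [W] would be a clique. *)
have NW : N != W.
  apply/eqP=> NW; case: nclW => u [v [uW vW uv /negP[]]].
  have TW : T = W by apply/eqP; rewrite eqEsubset sTW -NW sNT.
  have : \sum_(w in T) (adj x w : nat) <= \sum_(w in T) (adj u w : nat).
    by apply: minx; rewrite TW.
  rewrite -ltnS -cN (cardsD1 u) NW uW add1n ltnS -sum1_card TW.
  rewrite [X in _ <= X](bigD1 u) //= adj_irrefl add0n => H.
  rewrite (big_setD1 v) /= in H; last by rewrite !inE eq_sym uv.
  case auv: (adj u v) => //; move: H.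
  rewrite [X in _ <= X](bigD1 v) /= ?vW 1?eq_sym // auv add0n add1n ltnNge.
  move=> /negP[].
  rewrite big_mkcond [X in _ <= X]big_mkcond; apply: leq_sum => w _.
  rewrite !inE; case: (w == v); case: (w == u); case: (w \in W) => //=.
  by case: (adj u w).
pose T' := T :\: N.
have cT : #|N| + #|T'| = #|T| by rewrite -(cardsID N T) (setIidPr sNT).
have dNT' : [disjoint N & T'] by exact: disjointDr.
have eT : T = N :|: T' by rewrite -(setID T N) (setIidPr sNT).
have eW : W = N :|: (W :\: N) by rewrite -{1}(setID W N) (setIidPr sNW).
have [||I' [sI'T' indI' _ le']] := IH T'.
- by move: cT; rewrite cN; lia.
- exact: subset_trans (subsetDl _ _) sTW.
have xI' : x \notin I' by apply: contraL xN => /(subsetP sI'T'); rewrite inE => /andP[].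
exists (x |: I'); split.
- rewrite subUset sub1set xT; exact: subset_trans sI'T' (subsetDl _ _).
- have nx y : y \in I' -> ~~ adj x y.
    move=> /(subsetP sI'T'); rewrite !inE negb_and negb_or.
    by case/andP=> [/orP[/negP//|/andP[]]].
  apply/forall_inP=> u uI; apply/forall_inP=> v vI; move: uI vI; rewrite !inE.
  move=> /predU1P[->|uI] /predU1P[->|vI]; rewrite ?adj_irrefl //; first exact: nx.
    by rewrite adj_sym nx.
  by move/forall_inP: indI' => /(_ u uI)/forall_inP/(_ v vI).
- by move=> _; apply/set0Pn; exists x; rewrite !inE eqxx.
rewrite cardsU1 xI' -cT.
have e1 : ecount T T = ecount N T + ecount N T' + ecount T' T'.
  rewrite {1}eT ecountUl // -addnA; congr (_ + _).
  by rewrite {1}eT ecountUr // (ecountC T').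
have e2 : ecount T W = ecount N N + ecount N (W :\: N) + ecount T' W.
  by rewrite {1}eT ecountUl //; congr (_ + _); rewrite {1}eW ecountUr ?disjointDr.
have e3 : ecount N T = ecount N N + ecount N T' by rewrite {1}eT ecountUr.
have q3 : q <= ecount N (W :\: N) by apply: cutW => //; apply/set0Pn; exists x.
move: eNT; rewrite cN /=; set n := \sum_(y in T) _ => eNT.
(* This is the square of [2 * n.+1 - a.+1] being nonnegative. *)
have sq : 4 * a * n.+1 <= 4 * (n.+1 * n) + a.+1 ^ 2.
  move: (nat_Cauchy (2 * n.+1) a.+1).1; rewrite -!mulnn; clear; lia.
move: le' sq eNT q3; rewrite e1 e2 -/T'.
move: e3; move: (ecount N T) (ecount N T') (ecount N N) (ecount T' T').
move: (ecount T' W) (ecount N _) (a.+1 ^ 2) => e1' e2' c e3' e4' e5' e6' ->; clear; nia.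
Qed.

End EdgeCount.

(** * Numerical inequalities *)

Lemma product_lt_double (a b K : nat) : 0 < b ->
  2 * b * a.+1 * b.+1 + 5 <= 4 * b * K -> a.+1 * b.+1 < 2 * K.
Proof.
move=> b0 h; rewrite ltnNge; apply/negP=> le.
have := leq_mul (leqnn (2 * b)) le; move: h; rewrite -!mulnA; lia.
Qed.

(** This is the case of a clique [W] with [w] vertices: each of the [n] vertices of [T] has [w.-1]
    neighbours in [W]. *)
Lemma clique_inequality (a b K s w n : nat) : 0 < a -> a <= b ->
  a.+1 * b.+1 < 2 * K -> K < w + s -> 0 < n <= w ->
  a * n < b * s + n * w.-1.
Proof.
move=> a0 ab hK Kws /andP[n0 nw].
have aK : a < K by nia.
have [aw|wa] := ltnP a w.
  have [s0|s0] := posnP s.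
    have : a < w.-1 by lia.
    by rewrite s0 muln0 add0n mulnC ltn_pmul2l.
  have le : n * a <= n * w.-1 by rewrite leq_mul2l; apply/orP; right; lia.
  have : 0 < b * s by rewrite muln_gt0 s0 andbT; lia.
  by rewrite mulnC; lia.
(* Each vertex of [T] lacks [j] neighbours, at most [w * j] in total; [(w + j) ^ 2 < 2 * K] and
   [K < w + s] force [s > w * j]. *)
have [j ej] : exists j, a.+1 = w + j by exists (a.+1 - w); lia.
have j0 : 0 < j by lia.
have hc : (w + j) * (w + j) < 2 * K.
  by rewrite -ej; apply: leq_ltn_trans hK; rewrite leq_mul2l ltnS ab orbT.
have hs : w * j < s by nia.
have hb : w * j < b * s by nia.
have e : a * n + n = n * w + n * j by rewrite -mulnDr -ej; lia.
have e' : n * w.-1 + n = n * w by rewrite -mulnSr prednK //; lia.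
have := leq_mul nw (leqnn j); lia.
Qed.

Lemma cut_inequality (a b K s t alpha : nat) : a <= b -> 0 < t <= alpha ->
  a.+1 * b.+1 < 2 * K -> a.+1 ^ 2 * alpha + 5 <= 4 * b * K ->
  t * a.+1 ^ 2 < 4 * b * s + 2 * t * (K - s).
Proof.
move=> ab /andP[t0 ta] hK hal.
have hX : t * a.+1 ^ 2 < 4 * b * K.
  apply: leq_trans hal; rewrite mulnC addnC addSn ltnS.
  by apply: leq_trans (leq_addl _ _); rewrite leq_mul2l ta orbT.
have hY : t * a.+1 ^ 2 < 2 * t * K.
  rewrite mulnAC [2 * K * t]mulnC ltn_pmul2l //; apply: leq_ltn_trans hK.
  by rewrite -mulnn leq_mul2l ltnS ab orbT.
have [Ks|sK] := leqP K s.
  apply: leq_trans hX _; apply: leq_trans (leq_addr _ _).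
  by rewrite leq_mul2l Ks orbT.
have K0 : 0 < K by lia.
(* After multiplication by [K = s + r], the claim is [s] times the endpoint bound [hX] plus [r]
   times the endpoint bound [hY]. *)
rewrite -(ltn_pmul2r K0).
have [r eK] : exists r, K = s + r by exists (K - s); lia.
have r0 : 0 < r by lia.
have -> : K - s = r by rewrite eK addKn.
have -> : t * a.+1 ^ 2 * K = t * a.+1 ^ 2 * s + t * a.+1 ^ 2 * r.
  by rewrite -mulnDr -eK.
rewrite mulnDl (mulnAC _ s) (mulnAC _ r).
apply: (@leq_ltn_trans (4 * b * K * s + t * a.+1 ^ 2 * r)).
  by rewrite leq_add2r leq_mul2r ltnW ?orbT.
by rewrite ltn_add2l ltn_pmul2r.
Qed.

(** * The obstruction is excluded *)

Section Criterion.
Variables (G : sgraph) (a b K : nat).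
Hypotheses (a_gt0 : 0 < a) (leab : a <= b).
(** [G] stands for the graph left after the deletion; its connectivity enters only through [cutK]
    and [cardK]. *)
Hypothesis cutK : forall A B : {set G},
  A != set0 -> B != set0 -> [disjoint A & B] ->
  K <= ecount A B + #|~: (A :|: B)|.
Hypothesis cardK : K < #|G|.
Hypothesis boundK : 2 * b * a.+1 * b.+1 + 5 <= 4 * b * K.
Hypothesis boundalpha : a.+1 ^ 2 * independence_number G + 5 <= 4 * b * K.

Lemma disjoint_criterion (S T : {set G}) : [disjoint S & T] -> T != set0 ->
  a * #|T| < b * #|S| + ecount T (~: S).
Proof.
move=> dST T0; have b0 : 0 < b := leq_trans a_gt0 leab.
have hK := product_lt_double b0 boundK.
set W := ~: S; have cW : #|S| + #|W| = #|G| := cardsC S.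
have sTW : T \subset W by rewrite subsets_disjoint setCK disjoint_sym.
have [/forall_inP clq|/forall_inPn[x xW /forall_inPn[y yW nxy]]] :=
    boolP [forall x in W, forall y in W, (x == y) || adj x y].
  have -> : ecount T W = #|T| * #|W|.-1.
    rewrite -sum_nat_const; apply: eq_bigr => x /(subsetP sTW) xW.
    rewrite (bigD1 x) //= adj_irrefl add0n (cardD1 x) xW -sum1_card.
    apply: eq_big => y; first by rewrite !inE andbC.
    case/andP=> yW yx; move/forall_inP: (clq x xW) => /(_ y yW).
    by rewrite eq_sym (negbTE yx) /= => ->.
  apply: (@clique_inequality _ _ K) => //; first by rewrite addnC cW.
  by rewrite card_gt0 T0 subset_leq_card.
move: nxy; rewrite negb_or => /andP[xy nxy].
(* For [N] inside [W], the vertices outside [N] and [W :\: N] are those of [S], so [cutK] yields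
   [K - #|S|] edges. *)
have [||I [sIT indI I0 le]] := @greedy_independent G W a (K - #|S|) _ _ T sTW.
- move=> N sNW N0 NW; rewrite leq_subLR addnC.
  have eW : N :|: (W :\: N) = W by rewrite -{2}(setID W N) (setIidPr sNW).
  have := cutK N0 _ (disjointDr N W); rewrite eW setCK; apply.
  by rewrite setD_eq0; apply: contra NW => sWN; rewrite eqEsubset sNW.
- by exists x, y.
have := @cut_inequality a b K #|S| #|I| _ leab _ hK boundalpha.
rewrite card_gt0 I0 // independent_le // => /(_ isT) lt.
(* This bounds the factor [ecount T T + ecount T W] by [2 * ecount T W]. *)
have le2 := ecount_subr T sTW.
move: le lt le2; move: (ecount T T) (ecount T W) (#|I| * a.+1 ^ 2) => e1 e2 c.
rewrite -(mulnA 2 #|I|); move: (#|I| * (K - #|S|)) => d.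
by rewrite -!(mulnA 4); move: (b * #|S|) (a * #|T|) => m1 m2; clear; lia.
Qed.

(* Moving [S :&: T] out of both sets decreases the right-hand side at least as
   much as the left-hand side. *)
Lemma factor_criterion (S T : {set G}) : T != set0 ->
  a * #|T| + (T != setT) <= b * #|S| + ecount T (~: S).
Proof.
move=> T0; set I := S :&: T.
have dS : [disjoint S :\: T & T :\: S].
  by rewrite -setI_eq0; apply/eqP/setP=> x; rewrite !inE; do 2!case: (x \in _).
have dI : [disjoint T :\: S & I].
  by rewrite -setI_eq0; apply/eqP/setP=> x; rewrite !inE; do 2!case: (x \in _).
have dI' : [disjoint ~: S & I].
  by rewrite -setI_eq0; apply/eqP/setP=> x; rewrite !inE; do 2!case: (x \in _).
have eT : T = (T :\: S) :|: I.
  by apply/setP=> x; rewrite !inE; do 2!case: (x \in _).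
have eS' : ~: (S :\: T) = ~: S :|: I.
  by apply/setP=> x; rewrite !inE; do 2!case: (x \in _).
have cT : #|I| + #|T :\: S| = #|T| by rewrite -(cardsID S T) setIC.
have cS : #|I| + #|S :\: T| = #|S| by rewrite -(cardsID T S).
(* The strict inequality for the disjoint pair pays for the extra 1. *)
have [T'0|T'0] := eqVneq (T :\: S) set0; last first.
  have := disjoint_criterion dS T'0; rewrite eS' ecountUr //.
  have -> : ecount T (~: S) = ecount (T :\: S) (~: S) + ecount I (~: S).
    by rewrite {1}eT ecountUl.
  have le : ecount (T :\: S) I <= ecount I (~: S).
    by rewrite ecountC ecount_subr //; apply/subsetP=> x; rewrite !inE => /andP[].
  have := leq_mul leab (leqnn #|I|).
  by rewrite -cT -cS !mulnDr; case: (T != setT) => /=; lia.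
rewrite T'0 cards0 addn0 in cT.
have [S'0|S'0] := eqVneq (S :\: T) set0; last first.
  have : 0 < #|S :\: T| by rewrite card_gt0.
  have := leq_mul leab (leqnn #|I|).
  rewrite -cT -cS !mulnDr; case: (T != setT) => /=; nia.
have eST : S = T.
  by apply/eqP; rewrite eqEsubset -!setD_eq0 S'0 T'0 !eqxx.
rewrite eST; have [_|TT] := eqVneq T setT.
  by rewrite addn0; apply: leq_trans (leq_addr _ _); rewrite leq_mul2r leab orbT.
rewrite leq_add ?leq_mul2r ?leab ?orbT //=.
have dT : [disjoint T & ~: T] by rewrite -subsets_disjoint.
have CT : ~: T != set0 by apply: contra TT => /eqP C0; rewrite -(setCK T) C0 setC0.
(* With [S = T] a proper subset, the extra 1 is paid by an edge leaving [T], as [K > 0]. *)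
have := cutK T0 CT dT; rewrite setUCr setCT cards0 addn0.
by apply: leq_trans; have := product_lt_double (leq_trans a_gt0 leab) boundK; lia.
Qed.

(** A minimiser of [deficit] works: a degree below [a] would give an obstruction that
    [factor_criterion] forbids. *)
Lemma arc_factor (u v : G) : adj u v ->
  exists M : {set G * G},
    [/\ (u, v) \in M, forall x y, (x, y) \in M -> adj x y,
        forall x, a <= rdeg M x <= b & forall x, a <= cdeg M x <= b].
Proof.
move=> uv; have b0 : 0 < b := leq_trans a_gt0 leab.
pose adm := admissible b (@adj G) (u, v).
have adm0 : adm [set (u, v)].
  rewrite -[[set _]]setU0; apply/admissibleP; split=> [|x y|x|y].
  - by rewrite !inE eqxx.
  - by rewrite !inE orbF => /eqP[-> ->].
  - rewrite rdegU1 ?inE // {1}/rdeg big1; first by case: (_ == _).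
    by move=> ? _; rewrite inE.
  - rewrite cdegU1 ?inE // {1}/cdeg big1; first by case: (_ == _).
    by move=> ? _; rewrite inE.
case: (arg_minnP (deficit a) adm0) => M admM minM.
have noobs (S T : {set G}) : T != set0 ->
    b * #|S| + \sum_(y in T) \sum_(x in ~: S) (adj x y : nat)
      < a * #|T| + (T != setT) -> False.
  move=> T0 lt; have := leq_trans lt (factor_criterion S T0).
  have -> : ecount T (~: S) = \sum_(y in T) \sum_(x in ~: S) (adj x y : nat).
    by do 2!apply: eq_bigr => ? _; rewrite adj_sym.
  by rewrite ltnn.
have cge y : a <= cdeg M y.
  rewrite leqNgt; apply/negP=> lty.
  by have [S [T [T0 /noobs]]] := column_obstruction leab admM lty minM; apply.
(* Rows become columns in the converse, which is still a minimiser because adjacency is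
   symmetric. *)
have rge x : a <= rdeg M x.
  rewrite leqNgt; apply/negP=> ltx; rewrite -cdeg_converse in ltx.
  have [|S [T [T0 lt]]] := column_obstruction leab (admissible_converse admM) ltx.
    move=> M' admM'; rewrite deficit_converse -(deficit_converse _ M').
    apply: minM; apply/admissibleP.
    move/admissible_converse/admissibleP: admM' => [h1 h2 h3 h4]; split=> //.
  apply: (noobs S T T0); apply: leq_ltn_trans lt; rewrite leq_add2l.
  by do 2!(apply: leq_sum => ? _); rewrite adj_sym.
move/admissibleP: (admM) => [uvM MA Mr Mc].
by exists M; split=> // x; rewrite ?cge ?rge ?Mr ?Mc.
Qed.

End Criterion.

(** * From arc sets to fractional factors *)

Lemma rdeg_arcs (V : finType) (M : {set V * V}) x :
  rdeg M x = \sum_(p in M) ((p.1 == x) : nat).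
Proof.
have -> : \sum_(p in M) ((p.1 == x) : nat) =
          \sum_u \sum_v (if (u, v) \in M then (u == x) : nat else 0).
  by rewrite pair_bigA big_mkcond; apply: eq_bigr => -[].
rewrite (bigD1 x) //= [X in _ + X]big1 ?addn0.
  by apply: eq_bigr => y _; rewrite eqxx; case: (_ \in _).
by move=> u /negbTE ->; rewrite big1 // => y _; rewrite if_same.
Qed.

Lemma cdeg_arcs (V : finType) (M : {set V * V}) x :
  cdeg M x = \sum_(p in M) ((p.2 == x) : nat).
Proof.
rewrite -rdeg_converse rdeg_arcs (reindex_inj (h := fun p => (p.2, p.1))) /=.
  by apply: eq_bigl => -[u v]; rewrite inE.
by move=> [u v] [u' v'] [-> ->].
Qed.

Section FromArcs.
Local Open Scope ring_scope.

Lemma frac_covered_arcs (R : realType) (a b : nat) (G : sgraph) :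
  (forall u v : G, adj u v -> exists M : {set G * G},
    [/\ (u, v) \in M, forall x y, (x, y) \in M -> adj x y,
        forall x, (a <= rdeg M x <= b)%N & forall x, (a <= cdeg M x <= b)%N]) ->
  frac_covered R a b G.
Proof.
move=> HM e /imsetP[[u v] /=]; rewrite inE /= => uv ->{e}.
have [M [uvM MA Mr Mc]] := HM u v uv.
(* [c e] counts the orientations of [e] in [M], at most two, so [h] takes values 0, 1/2 and 1. *)
pose c (e : {set G}) := (\sum_(p in M) ([set p.1; p.2] == e : nat))%N.
pose h (e : {set G}) : R := (c e)%:R / 2.
exists [set e in edges G | 0 < h e].
  exists h; split=> //; split=> [e /imsetP[[x y] /= _ ->]|x].
    rewrite /h divr_ge0 ?ler0n //= ler_pdivrMr ?ltr0n // mul1r ler_nat.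
    apply: (@leq_trans #|[set (x, y); (y, x)]|); last first.
      by rewrite cards2; case: (_ != _).
    rewrite /c -sum1_card big_mkcond [X in (_ <= X)%N]big_mkcond.
    apply: leq_sum => -[s t] _ /=.
    case: ifP => // /MA st; case: eqP => // /setP est.
    have st' : s != t by apply: contraTneq st => ->; rewrite adj_irrefl.
    move: (est s) (est t); rewrite !inE !xpair_eqE !eqxx orbT /=.
    move=> /esym/orP[]/eqP es /esym/orP[]/eqP et; move: st'; subst s t;
      by rewrite !eqxx ?orbT.
  have -> : \sum_(e in edges G | x \in e) h e = (rdeg M x + cdeg M x)%:R / 2.
    rewrite -mulr_suml -natr_sum; congr (_%:R / _).
    rewrite /c exchange_big /= rdeg_arcs cdeg_arcs -big_split /=.
    apply: eq_bigr => -[s t] /MA st /=.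
    rewrite (eq_bigr (fun e => (e == [set s; t]) : nat)); last first.
      by move=> e _; rewrite eq_sym.
    have ste : [set s; t] \in edges G by apply/imsetP; exists (s, t); rewrite ?inE.
    rewrite big_mkcondr big_mkcond (bigD1 [set s; t]) //= ste eqxx big1; last first.
      by move=> e /negbTE ->; rewrite !if_same.
    rewrite !inE addn0 !(eq_sym x).
    have [sx|_] := eqVneq s x; have [tx|_] := eqVneq t x => //=.
    by rewrite sx tx adj_irrefl in st.
  move: (Mr x) (Mc x) => /andP[r1 r2] /andP[c1 c2].
  rewrite ler_pdivlMr ?ltr0n // ler_pdivrMr ?ltr0n // -!natrM !ler_nat.
  by apply/andP; split; lia.
rewrite inE; apply/andP; split; first by apply/imsetP; exists (u, v); rewrite ?inE.
by rewrite /h divr_gt0 ?ltr0n // /c (bigD1 (u, v)) //= eqxx add1n.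
Qed.

End FromArcs.

(** * Vertex deletion and the bounds on connectivity *)

Lemma ecount_val (G : sgraph) (U : {set G}) (A B : {set del_vertices U}) :
  ecount A B = ecount (val @: A) (val @: B).
Proof.
rewrite /ecount big_imset /=; last by move=> ? ? _ _; apply: val_inj.
apply: eq_bigr => x _; rewrite big_imset //= => ? ? _ _; exact: val_inj.
Qed.

Lemma card_del_vertices (G : sgraph) (U : {set G}) :
  #|del_vertices U| + #|U| = #|G|.
Proof.
have -> : #|del_vertices U| = #|~: U|.
  by rewrite card_sig; apply: eq_card => x; rewrite !inE.
by rewrite addnC cardsC.
Qed.

Lemma independence_number_del (G : sgraph) (U : {set G}) :
  independence_number (del_vertices U) <= independence_number G.
Proof.
apply/bigmax_leqP=> I indI; rewrite -(card_imset _ val_inj).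
apply: independent_le; apply/forall_inP=> _ /imsetP[x xI ->].
apply/forall_inP=> _ /imsetP[y yI ->].
by move/forall_inP: indI => /(_ x xI)/forall_inP/(_ y yI).
Qed.

(** Seen in [G], the vertices outside both sets are those counted in the deleted graph plus the
    vertices of [U]. *)
Lemma connectivity_del_cut (G : sgraph) (U : {set G})
    (A B : {set del_vertices U}) :
  A != set0 -> B != set0 -> [disjoint A & B] ->
  connectivity G - #|U| <= ecount A B + #|~: (A :|: B)|.
Proof.
move=> A0 B0 dAB; rewrite ecount_val leq_subLR.
have A0' : val @: A != set0.
  by case/set0Pn: A0 => x xA; apply/set0Pn; exists (val x); apply: imset_f.
have B0' : val @: B != set0.
  by case/set0Pn: B0 => x xA; apply/set0Pn; exists (val x); apply: imset_f.
have dAB' : [disjoint val @: A & val @: B].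
  by rewrite imset_disjoint //; apply: val_inj.
apply: leq_trans (connectivity_le_ecount A0' B0' dAB') _.
rewrite addnCA leq_add2l -imsetU.
have := cardsC (val @: (A :|: B)); rewrite (card_imset _ val_inj).
have := card_del_vertices U; rewrite -(cardsC (A :|: B)) => <-.
by rewrite -addnA => /addnI ->; rewrite addnC.
Qed.

Local Open Scope ring_scope.

Theorem theorem3 (R : realType) (a b k : nat) (G : sgraph)
  (ha : (1 <= a)%N) (hab : (a <= b)%N)
  (hkappa : Num.max
     ((2 * b%:R * (a%:R + 1) * (b%:R + 1) + 4 * b%:R * k%:R + 5) / (4 * b%:R))
     (((a%:R + 1) ^+ 2 * (independence_number G)%:R + 4 * b%:R * k%:R + 5)
        / (4 * b%:R))
     <= (connectivity G)%:R :> R) :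
  frac_critical_covered R a b k G.
Proof.
move=> U cU; have b0 : (0 < b)%N := leq_trans ha hab.
have b4 : 0 < 4 * b%:R :> R by rewrite mulr_gt0 ?ltr0n.
move: hkappa; rewrite ge_max !ler_pdivrMr // => /andP[].
rewrite !natr1 -!(natrX, natrM, natrD) !ler_nat => h1 h2.
(* This makes the truncated difference [K] below a true one. *)
have kk : (k < connectivity G)%N.
  rewrite ltnNge; apply/negP=> /(leq_mul (leqnn (4 * b))).
  by move: h1; rewrite (mulnC (connectivity G)); lia.
apply: frac_covered_arcs => u v uv.
pose K := (connectivity G - k)%N.
have eK : (4 * b * connectivity G = 4 * b * K + 4 * b * k)%N.
  by rewrite -mulnDr subnK // ltnW.
apply: (@arc_factor (del_vertices U) a b K) => //.
- by rewrite /K -cU; exact: connectivity_del_cut.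
- have := connectivity_lt_card (val u); rewrite -(card_del_vertices U) cU /K; lia.
- by move: h1; rewrite (mulnC (connectivity G)) eK; lia.
- have := leq_mul (leqnn (a.+1 ^ 2)) (independence_number_del U).
  by move: h2; rewrite (mulnC (connectivity G)) eK; lia.
Qed.
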